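(* Let $r\geq 1$ and $n\geq 2$ be integers, and let $C_n$ be the cycle on $n$ vertices (for $n=2$, $C_2$ is a single edge on two vertices). Then for any cross-intersecting pair $(\mathcal{A},\mathcal{B})$ in $\mathcal{J}^r(C_n)$, we have $|\mathcal{A}|+|\mathcal{B}|\leq |\mathcal{J}^r(C_n)|$.
   Context: For a graph $G$, $\mathcal{J}^r(G)$ denotes the family of all independent vertex sets of size $r$ in $G$. A pair $(\mathcal{A},\mathcal{B})$ is a cross-intersecting pair in $\mathcal{J}^r(G)$ if $\mathcal{A},\mathcal{B}\subseteq\mathcal{J}^r(G)$ and $A\cap B\neq\emptyset$ for every $A\in\mathcal{A}$, $B\in\mathcal{B}$ (the families need not be non-empty or intersecting themselves). *)

(* Defs.v *)
From mathcomp Require Import all_boot.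

Set Implicit Arguments.
Unset Strict Implicit.
Unset Printing Implicit Defensive.

(* A graph on the vertex set T is given by its adjacency relation e : rel T. *)

Section IndependentSets.

Variables (T : finType) (e : rel T).

Definition independent (A : {set T}) : bool :=
  [forall x in A, forall y in A, ~~ e x y].

Definition indep_sets (r : nat) : {set {set T}} :=
  [set A : {set T} | independent A & #|A| == r].

Definition cross_intersecting (r : nat) (FA FB : {set {set T}}) : Prop :=
  [/\ FA \subset indep_sets r, FB \subset indep_sets r
    & {in FA & FB, forall A B : {set T}, A :&: B != set0}].

End IndependentSets.

(* ordS is the successor modulo n. For n = 2 this is the single edge {0, 1};
   for n = 1 it would be a loop, hence the hypothesis of cycle_rel_irr. *)
Definition cycle_rel (n : nat) : rel 'I_n :=
  fun i j => (j == ordS i) || (i == ordS j).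

Lemma cycle_rel_sym (n : nat) : symmetric (@cycle_rel n).
Proof. by move=> i j; rewrite /cycle_rel orbC. Qed.

Lemma cycle_rel_irr (n : nat) : 1 < n -> irreflexive (@cycle_rel n).
Proof.
move=> n_gt1 i; rewrite /cycle_rel orbb; apply/negbTE/eqP => /(congr1 val) /=.
have := ltn_ord i; rewrite leq_eqVlt => /orP[/eqP iE | lt_i].
  rewrite iE modnn => i0.
  by move: n_gt1; rewrite -iE i0.
by rewrite modn_small // => /eqP; rewrite eqn_leq ltnn andbF.
Qed.

(* Main.v *)
(** In a cycle, an independent set is disjoint from its rotation by one step.
    Hence rotation maps the first family injectively into the [r]-sets outside
    the second one. *)

Require Import Defs.
From mathcomp Require Import all_boot.

(** Each vertex is adjacent to its successor, so an independent [A] misses its rotation, and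
    cross-intersection bars that rotation from [FB]. Rotation is a cycle automorphism, so the
    rotated [FA] and [FB] are disjoint subfamilies of [indep_sets]. *)

Lemma independent_rot_disjoint (n : nat) (A : {set 'I_n}) :
  independent (@cycle_rel n) A -> A :&: @ordS n @: A = set0.
Proof.
move=> indA; apply/eqP/set0Pn => -[x /setIP[xA /imsetP[y yA xE]]].
move/forall_inP/(_ y yA)/forall_inP/(_ x xA): indA.
by rewrite /cycle_rel xE eqxx.
Qed.

(** Adjacency is defined through [ordS] alone, so injectivity of [ordS] makes rotation preserve it
    both ways. *)
Lemma rot_indep_sets (r n : nat) (A : {set 'I_n}) :
  A \in indep_sets (@cycle_rel n) r ->
  @ordS n @: A \in indep_sets (@cycle_rel n) r.
Proof.
rewrite !inE => /andP[indA cardA].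
rewrite (card_imset _ (can_inj (@ordSK n))) cardA andbT.
apply/forall_inP => _ /imsetP[x xA ->]; apply/forall_inP => _ /imsetP[y yA ->].
rewrite /cycle_rel !(inj_eq (can_inj (@ordSK n))).
exact: (forall_inP (forall_inP indA x xA) y yA).
Qed.

Theorem theorem1p9 (r n : nat) (hr : 1 <= r) (hn : 2 <= n)
    (FA FB : {set {set 'I_n}})
    (hAB : cross_intersecting (@cycle_rel n) r FA FB) :
  #|FA| + #|FB| <= #|indep_sets (@cycle_rel n) r|.
Proof.
case: hAB => /subsetP sA sB crossAB.
pose rotFA := [set @ordS n @: A | A : {set 'I_n} in FA].
have <- : #|rotFA| = #|FA|.
  exact/card_imset/imset_inj/(can_inj (@ordSK n)).
have rotFAB : rotFA :&: FB = set0.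
  apply/eqP/set0Pn => -[_ /setIP[/imsetP[A AFA ->] rotA_FB]].
  have /[!inE]/andP[indA _] := sA A AFA.
  (* A rotated member of [FA] lying in [FB] would have to meet its own preimage [A]. *)
  by have := crossAB _ _ AFA rotA_FB; rewrite (independent_rot_disjoint _ _ indA) eqxx.
rewrite -cardsUI rotFAB cards0 addn0; apply/subset_leq_card.
rewrite subUset sB andbT; apply/subsetP => _ /imsetP[A AFA ->].
exact/rot_indep_sets/sA.
Qed.
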